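(* Let $n$ be a positive integer and let $G$ be a group with exactly $n$ centralizers, i.e. $|\mathcal{C}(G)|=n$. Then: (1) there are only finitely many groups $H$ with $|\mathcal{C}(H)|=n$, up to isoclinism; (2) there exists a finite group $K$ such that $K$ is isoclinic to $G$ and $|\mathcal{C}(G)|=|\mathcal{C}(K)|$.
   Context: For a group $G$, $\mathcal{C}(G)=\{C_G(x): x\in G\}$ denotes the set of centralizers of elements of $G$. Two groups $G$ and $H$ are isoclinic if there are isomorphisms $\varphi: G/Z(G)\to H/Z(H)$ and $\phi: G'\to H'$ such that whenever $\varphi(g_1Z(G))=h_1Z(H)$ and $\varphi(g_2Z(G))=h_2Z(H)$, one has $\phi([g_1,g_2])=[h_1,h_2]$. *)

(* Defs.v *)
From Stdlib Require Import List Arith.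
Import ListNotations.

Record grp := Grp {
  carrier :> Type;
  gmul : carrier -> carrier -> carrier;
  gone : carrier;
  ginv : carrier -> carrier;
  gmulA : forall x y z, gmul x (gmul y z) = gmul (gmul x y) z;
  gmul1l : forall x, gmul gone x = x;
  gmul1r : forall x, gmul x gone = x;
  gmulVl : forall x, gmul (ginv x) x = gone;
  gmulVr : forall x, gmul x (ginv x) = gone
}.

Arguments gmul {g}.
Arguments gone {g}.
Arguments ginv {g}.

Definition centralizer (G : grp) (x : G) : G -> Prop :=
  fun y => gmul x y = gmul y x.

Definition same_centralizer (G : grp) (x y : G) : Prop :=
  forall z : G, centralizer G x z <-> centralizer G y z.

Definition num_centralizers (G : grp) (n : nat) : Prop :=
  exists f : nat -> G,
    (forall i j, i < n -> j < n ->
       same_centralizer G (f i) (f j) -> i = j) /\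
    (forall x : G, exists i, i < n /\ same_centralizer G x (f i)).

Definition center (G : grp) (z : G) : Prop :=
  forall y : G, gmul z y = gmul y z.

Definition comm (G : grp) (x y : G) : G :=
  gmul (gmul (ginv x) (ginv y)) (gmul x y).

Inductive derived (G : grp) : G -> Prop :=
  | derived1 : derived G gone
  | derivedM : forall x y g, derived G g -> derived G (gmul (comm G x y) g).

Definition cosetZ_eq (G : grp) (x y : G) : Prop := center G (gmul (ginv x) y).

(** Isoclinism of G and H.  An isomorphism G/Z(G) -> H/Z(H) is given by a lift
    [f : G -> H] of it to representatives: the induced map xZ(G) |-> f(x)Z(H) is
    well defined, a homomorphism, injective and surjective.  The isomorphism
    G' -> H' is [psi] restricted to G'.  Compatibility: whenever phi(g1 Z(G)) = h1 Z(H)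
    and phi(g2 Z(G)) = h2 Z(H), psi([g1,g2]) = [h1,h2]. *)
Definition isoclinic (G H : grp) : Prop :=
  exists (f : G -> H) (psi : G -> H),
    (forall x y : G, cosetZ_eq G x y -> cosetZ_eq H (f x) (f y)) /\
    (forall x y : G, cosetZ_eq H (f (gmul x y)) (gmul (f x) (f y))) /\
    (forall x y : G, cosetZ_eq H (f x) (f y) -> cosetZ_eq G x y) /\
    (forall h : H, exists x : G, cosetZ_eq H (f x) h) /\
    (forall g : G, derived G g -> derived H (psi g)) /\
    (forall g1 g2 : G, derived G g1 -> derived G g2 ->
        psi (gmul g1 g2) = gmul (psi g1) (psi g2)) /\
    (forall g1 g2 : G, derived G g1 -> derived G g2 -> psi g1 = psi g2 -> g1 = g2) /\
    (forall h : H, derived H h -> exists g : G, derived G g /\ psi g = h) /\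
    (forall (g1 g2 : G) (h1 h2 : H),
        cosetZ_eq H (f g1) h1 -> cosetZ_eq H (f g2) h2 ->
        psi (comm G g1 g2) = comm H h1 h2).

Definition finite_grp (G : grp) : Prop :=
  exists l : list G, forall x : G, In x l.

(* Main.v *)
(** Fix x_1, ..., x_n whose centralizers are all the centralizers of G.  If y and y' have
    the same centralizer, and so do x_i y and x_i y' for every i, then y^-1 y' commutes
    with every x_i and hence is central.  So |G : Z(G)| <= n^(n+1).

    Let t_1, ..., t_M represent the cosets of Z(G).  By Schur's argument each element of G'
    is a product of at most M^3 commutators [t_i, t_j]; so the isoclinism class of G is
    determined by the products of cosets of Z(G) together with the equalities between words
    of length at most M^3 + 1 in these commutators.  This is finitely much data, whence (1).

    For (2), let Z_1 be the subgroup generated by the finitely many central elements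
    t_k^-1 t_i t_j, and let P be the union of the t_i Z_1, a subgroup with P Z(G) = G.  Since
    Z_1 is finitely generated abelian, some e > 0 kills its torsion.  As G' is torsion,
    N = Z_1^e meets G' trivially, so P/N is isoclinic to G, and it is finite.  Finally,
    isoclinic groups have equally many centralizers. *)

Require Import Defs.
From Stdlib Require Import List Arith.
From Stdlib Require Import Lia ClassicalEpsilon FinFun.
From Stdlib Require Import FunctionalExtensionality PropExtensionality ProofIrrelevance.
Import ListNotations.

Declare Scope grp_scope.
Delimit Scope grp_scope with g.
Local Notation "1" := gone : grp_scope.
Local Notation "x * y" := (gmul x y) : grp_scope.
Local Notation "x ^-1" := (ginv x) (at level 3, left associativity, format "x ^-1") : grp_scope.
Local Notation "[~ x , y ]" := (comm _ x y) (at level 0) : grp_scope.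
Local Open Scope grp_scope.

(** * Finiteness principles *)

Lemma pigeonhole {A} (l : list A) (F : nat -> A -> Prop) :
  (forall i, exists a, In a l /\ F i a) ->
  exists i j a, i < j /\ j <= length l /\ F i a /\ F j a.
Proof.
intros HF.
set (f := fun i => proj1_sig (constructive_indefinite_description _ (HF i))).
assert (Hf : forall i, In (f i) l /\ F i (f i)).
{ intros i. exact (proj2_sig (constructive_indefinite_description _ (HF i))). }
apply NNPP; intros Hno.
assert (Hinj : forall i j, i < j -> j <= length l -> f i <> f j).
{ intros i j ij jl E. apply Hno. exists i, j, (f i).
  repeat split; auto; try apply Hf. rewrite E; apply Hf. }
assert (Hnd : NoDup (map f (seq 0 (S (length l))))).
{ apply Injective_map_NoDup_in; [| apply seq_NoDup].
  intros i j Hi Hj E. apply in_seq in Hi, Hj.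
  destruct (lt_eq_lt_dec i j) as [[H | H] | H]; trivial; exfalso.
  - apply (Hinj i j); auto; lia.
  - apply (Hinj j i); auto; lia. }
apply NoDup_incl_length with (l' := l) in Hnd.
- rewrite length_map, length_seq in Hnd. lia.
- intros a Ha. apply in_map_iff in Ha. destruct Ha as (i & <- & _). apply Hf.
Qed.

Lemma finite_words {A} (l : list A) (r : nat) :
  exists L, forall w, incl w l -> length w <= r -> In w L.
Proof.
induction r as [|r [L HL]].
- exists [[]]. intros [|a w] _ Hw; [now left | simpl in Hw; lia].
- exists ([] :: flat_map (fun a => map (cons a) L) l).
  intros [|a w] Hi Hw; [now left | right].
  apply in_flat_map. exists a. split; [apply Hi; now left |].
  apply in_map, HL; [intros x Hx; apply Hi; now right | simpl in Hw; lia].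
Qed.

(** One witness is chosen for each [a] in [l] that has any; this extracts finitely many
    representatives from finitely many labels. *)
Lemma finite_image {A B} (R : A -> B -> Prop) (l : list A) :
  exists l' : list B, length l' <= length l /\
    forall a b, In a l -> R a b -> exists b', In b' l' /\ R a b'.
Proof.
induction l as [|a l [l' [Hlen Hl']]].
- exists []. split; auto. intros a b [].
- destruct (classic (exists b, R a b)) as [[b Hb] | Hno].
  + exists (b :: l'). split; [simpl; lia |].
    intros a' b' [<- | Ha'] Hab; [exists b; split; auto; now left |].
    destruct (Hl' a' b' Ha' Hab) as (c & Hc & Hac). exists c. split; auto. now right.
  + exists l'. split; [simpl; lia |].
    intros a' b' [<- | Ha'] Hab; [exfalso; apply Hno; now exists b' |].
    now apply (Hl' a' b').
Qed.

(** Each [a] splits the class [P] in two, so at most [2 ^ length l] types occur, and one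
    representative of each inhabited type is kept. *)
Lemma finite_types {X A} (Phi : X -> A -> Prop) (l : list A) (P : X -> Prop) :
  exists xs, forall x, P x ->
    exists x', In x' xs /\ P x' /\ forall a, In a l -> (Phi x a <-> Phi x' a).
Proof.
revert P; induction l as [|a l IH]; intros P.
- destruct (classic (exists x, P x)) as [[x0 Hx0] | Hno].
  + exists [x0]. intros x Hx. exists x0. split; [now left |]. split; auto. intros a [].
  + exists []. intros x Hx. exfalso. apply Hno. now exists x.
- destruct (IH (fun x => P x /\ Phi x a)) as [xs Hxs].
  destruct (IH (fun x => P x /\ ~ Phi x a)) as [ys Hys].
  exists (xs ++ ys). intros x Hx.
  destruct (classic (Phi x a)) as [Ha | Ha].
  + destruct (Hxs x (conj Hx Ha)) as (x' & Hin & [HP Ha'] & H).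
    exists x'. split; [apply in_or_app; auto |]. split; auto.
    intros b [<- | Hb]; auto. tauto.
  + destruct (Hys x (conj Hx Ha)) as (x' & Hin & [HP Ha'] & H).
    exists x'. split; [apply in_or_app; auto |]. split; auto.
    intros b [<- | Hb]; auto. tauto.
Qed.

Lemma length_le_occ {A} (C w : list A)
  (eqd : forall a b : A, {a = b} + {a <> b}) (k : nat) :
  incl w C -> (forall c, count_occ eqd w c <= k) -> length w <= Nat.mul (length C) k.
Proof.
revert w; induction C as [|c C IH]; intros w Hi Hk.
- destruct w as [|a w]; auto. destruct (Hi a); now left.
- assert (Hlen : length w = count_occ eqd w c + length (remove eqd c w)).
  { clear. induction w as [|a w IH]; auto. simpl.
    destruct (eqd a c); destruct (eqd c a); try congruence; simpl; lia. }
  assert (length (remove eqd c w) <= Nat.mul (length C) k).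
  { apply IH.
    - intros a Ha. apply in_remove in Ha. destruct Ha as [Ha Hne].
      destruct (Hi a Ha); [congruence | assumption].
    - intros a. specialize (Hk a).
      destruct (eqd a c) as [-> | Hne].
      + rewrite (proj1 (count_occ_not_In eqd _ c)); [lia | apply remove_In].
      + replace (count_occ eqd (remove eqd c w) a) with (count_occ eqd w a); trivial.
        clear - Hne. induction w as [|b w IH]; auto. simpl.
        destruct (eqd b a), (eqd c b); simpl; try destruct (eqd b a); congruence. }
  specialize (Hk c). simpl. lia.
Qed.

(** * Elementary group theory *)

Lemma gmulKl {G : grp} (x y : G) : x^-1 * (x * y) = y.
Proof. now rewrite gmulA, gmulVl, gmul1l. Qed.

Lemma gmulKr {G : grp} (x y : G) : x * (x^-1 * y) = y.
Proof. now rewrite gmulA, gmulVr, gmul1l. Qed.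

Lemma gmulI {G : grp} (x y z : G) : x * y = x * z -> y = z.
Proof. intros E. rewrite <- (gmulKl x y), E. apply gmulKl. Qed.

Lemma gmulIr {G : grp} (x y z : G) : y * x = z * x -> y = z.
Proof.
intros E. rewrite <- (gmul1r _ y), <- (gmul1r _ z), <- (gmulVr _ x), !gmulA.
now rewrite E.
Qed.

Lemma ginv1 {G : grp} : (1 : G)^-1 = 1.
Proof. apply (gmulI 1). now rewrite gmulVr, gmul1l. Qed.

Lemma ginvK {G : grp} (x : G) : x^-1^-1 = x.
Proof. apply (gmulI (x^-1)). now rewrite gmulVr, gmulVl. Qed.

Lemma ginvM {G : grp} (x y : G) : (x * y)^-1 = y^-1 * x^-1.
Proof.
apply (gmulI (x * y)). now rewrite gmulVr, <- gmulA, gmulKr, gmulVr.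
Qed.

(* Together with associativity these rules form the classical complete rewriting system for free
   groups: words are reduced and bracketed to the right. *)
#[local] Hint Rewrite @gmul1l @gmul1r @gmulVl @gmulVr @ginv1 @ginvK @ginvM
  @gmulKl @gmulKr : grp.
#[local] Hint Rewrite <- @gmulA : grp.

Ltac gsimpl := unfold comm; autorewrite with grp.
Ltac group := gsimpl; reflexivity.

Lemma gmul_eq1 {G : grp} (x y : G) : x * y^-1 = 1 <-> x = y.
Proof.
split; [intros E | intros ->; apply gmulVr].
apply (gmulIr (y^-1)). now rewrite E, gmulVr.
Qed.

Lemma comm_eq1 {G : grp} (x y : G) : [~ x, y] = 1 <-> x * y = y * x.
Proof.
unfold comm. rewrite <- ginvM. split; intros E.
- apply (gmulI ((y * x)^-1)). now rewrite E, gmulVl.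
- now rewrite E, gmulVl.
Qed.

Lemma ginv_comm {G : grp} (x y : G) : [~ x, y]^-1 = [~ y, x].
Proof. group. Qed.

Fixpoint gpow {G : grp} (x : G) (k : nat) : G :=
  match k with 0 => 1 | S k => x * gpow x k end.
Local Notation "x ^ k" := (gpow x k) : grp_scope.

Lemma gpow_add {G : grp} (x : G) j k : x ^ (j + k) = x ^ j * x ^ k.
Proof. induction j as [|j IH]; simpl; [now rewrite gmul1l | now rewrite IH, gmulA]. Qed.

Lemma gpow_mul {G : grp} (x : G) j k : x ^ (j * k) = (x ^ k) ^ j.
Proof. induction j as [|j IH]; simpl; [trivial | now rewrite gpow_add, IH]. Qed.

Lemma gpow1 {G : grp} k : (1 : G) ^ k = 1.
Proof. induction k as [|k IH]; simpl; [trivial | now rewrite IH, gmul1l]. Qed.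

Lemma gpow_commute {G : grp} (x y : G) k : x * y = y * x -> x ^ k * y = y * x ^ k.
Proof.
intros E. induction k as [|k IH]; simpl; [now rewrite gmul1l, gmul1r |].
now rewrite <- gmulA, IH, !gmulA, E.
Qed.

Lemma gpowM {G : grp} (x y : G) k : x * y = y * x -> (x * y) ^ k = x ^ k * y ^ k.
Proof.
intros E. induction k as [|k IH]; simpl; [now rewrite gmul1l |].
rewrite IH, <- !gmulA. f_equal. rewrite !gmulA. f_equal.
symmetry. now apply gpow_commute.
Qed.

Lemma gpowV {G : grp} (x : G) k : x^-1 ^ k = (x ^ k)^-1.
Proof.
induction k as [|k IH]; simpl; [now rewrite ginv1 |].
rewrite IH, <- ginvM. f_equal. now apply gpow_commute.
Qed.

Lemma gpow_conj {G : grp} (x y : G) k : (y^-1 * (x * y)) ^ k = y^-1 * (x ^ k * y).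
Proof. induction k as [|k IH]; simpl; [group | rewrite IH; group]. Qed.

Lemma gpow_eq_diff {G : grp} (x : G) i j : i <= j -> (x ^ i)^-1 * x ^ j = x ^ (j - i).
Proof.
intros H. replace j with (i + (j - i)) at 1 by lia. now rewrite gpow_add, gmulKl.
Qed.

(** * Congruence modulo the center *)

Lemma center1 {G : grp} : center G 1.
Proof. intros y. now rewrite gmul1l, gmul1r. Qed.

Lemma centerM {G : grp} (x y : G) : center G x -> center G y -> center G (x * y).
Proof. intros Hx Hy z. now rewrite <- gmulA, Hy, gmulA, Hx, gmulA. Qed.

Lemma centerV {G : grp} (x : G) : center G x -> center G (x^-1).
Proof.
intros Hx y. apply (gmulI x). rewrite gmulKr, gmulA, Hx, <- gmulA, gmulVr.
now rewrite gmul1r.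
Qed.

Lemma centerX {G : grp} (x : G) k : center G x -> center G (x ^ k).
Proof. intros Hx. induction k; [apply center1 | now apply centerM]. Qed.

Record subgroup {G : grp} (P : G -> Prop) : Prop := Subgroup {
  subgroup1 : P 1;
  subgroupM : forall x y, P x -> P y -> P (x * y);
  subgroupV : forall x, P x -> P (x^-1)
}.

Lemma center_subgroup (G : grp) : subgroup (center G).
Proof. exact (Subgroup _ _ center1 centerM centerV). Qed.

(** Congruences are treated modulo a general subgroup [N], to serve both for the center and for the
    subgroup factored out in the finite quotient. *)
Lemma congr_sym {G : grp} (N : G -> Prop) (x y : G) :
  subgroup N -> N (x^-1 * y) -> N (y^-1 * x).
Proof. intros HN H. apply (subgroupV N HN) in H. revert H. now gsimpl. Qed.

Lemma congr_trans {G : grp} (N : G -> Prop) (x y z : G) :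
  subgroup N -> N (x^-1 * y) -> N (y^-1 * z) -> N (x^-1 * z).
Proof. intros HN H K. generalize (subgroupM N HN _ _ H K). now gsimpl. Qed.

Lemma congr_mul {G : grp} (N : G -> Prop) (x x' y y' : G) :
  subgroup N -> (forall z, N z -> center G z) ->
  N (x^-1 * x') -> N (y^-1 * y') -> N ((x * y)^-1 * (x' * y')).
Proof.
intros HN NZ H K.
replace ((x * y)^-1 * (x' * y')) with (y^-1 * (x^-1 * x') * y') by group.
rewrite <- (NZ _ H (y^-1)), <- gmulA. now apply (subgroupM N HN).
Qed.

Lemma coset_refl {G : grp} (x : G) : cosetZ_eq G x x.
Proof. unfold cosetZ_eq. rewrite gmulVl. apply center1. Qed.

Lemma coset_sym {G : grp} (x y : G) : cosetZ_eq G x y -> cosetZ_eq G y x.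
Proof. apply congr_sym, center_subgroup. Qed.

Lemma coset_trans {G : grp} (x y z : G) :
  cosetZ_eq G x y -> cosetZ_eq G y z -> cosetZ_eq G x z.
Proof. apply congr_trans, center_subgroup. Qed.

Lemma coset_mul {G : grp} (x x' y y' : G) :
  cosetZ_eq G x x' -> cosetZ_eq G y y' -> cosetZ_eq G (x * y) (x' * y').
Proof. apply congr_mul; auto using center_subgroup. Qed.

Lemma comm_coset_l {G : grp} (x x' y : G) :
  cosetZ_eq G x x' -> [~ x, y] = [~ x', y].
Proof.
intros H. rewrite <- (gmulKr x x'). set (z := x^-1 * x').
assert (Hz : center G z) by exact H.
unfold comm. replace (x * z * y) with (x * y * z) by (now rewrite <- !gmulA, (Hz y)).
replace ((x * z)^-1 * y^-1 * (x * y * z)) with (z^-1 * ([~ x, y] * z)) by group.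
now rewrite <- (Hz [~ x, y]), gmulKl.
Qed.

Lemma comm_coset {G : grp} (x x' y y' : G) :
  cosetZ_eq G x x' -> cosetZ_eq G y y' -> [~ x, y] = [~ x', y'].
Proof.
intros Hx Hy. rewrite (comm_coset_l _ _ _ Hx).
rewrite <- (ginv_comm y x'), <- (ginv_comm y' x'). f_equal. now apply comm_coset_l.
Qed.

(** As [x, g^-1] = (x^-1 g x) g^-1, the hypothesis says that x and y conjugate every g alike, so y
    x^-1 is central. *)
Lemma coset_of_comm {G : grp} (x y : G) :
  (forall g, [~ x, g] = [~ y, g]) -> cosetZ_eq G x y.
Proof.
intros H.
assert (Hc : forall g, y * x^-1 * g = g * (y * x^-1)).
{ intros g.
  assert (E : x^-1 * (g * x) = y^-1 * (g * y)).
  { apply (gmulIr (g^-1)). generalize (H (g^-1)). now gsimpl. }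
  replace (y * x^-1 * g) with (y * (x^-1 * (g * x)) * x^-1) by group.
  rewrite E. group. }
(* Centrality of y x^-1, tested on x g x^-1, becomes that of its conjugate x^-1 y. *)
intros g. apply (gmulI x), (gmulIr (x^-1)).
generalize (Hc (x * (g * x^-1))). now gsimpl.
Qed.

(** * Products of commutators *)

(** Words are lists of pairs rather than of commutators, so that they can be carried entry by entry
    to another group. *)
Fixpoint cprod {G : grp} (w : list (G * G)) : G :=
  match w with [] => 1 | p :: w => [~ fst p, snd p] * cprod w end.

Lemma cprod_app {G : grp} (v w : list (G * G)) : cprod (v ++ w) = cprod v * cprod w.
Proof.
induction v as [|p v IH]; simpl; [now rewrite gmul1l | now rewrite IH, gmulA].
Qed.

Definition swap {A : Type} (p : A * A) : A * A := (snd p, fst p).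

Lemma cprod_rev {G : grp} (w : list (G * G)) : cprod (map swap (rev w)) = (cprod w)^-1.
Proof.
induction w as [|p w IH]; simpl; [now rewrite ginv1 |].
rewrite map_app, cprod_app, IH, ginvM, ginv_comm. simpl. now rewrite gmul1r.
Qed.

Lemma derivedP {G : grp} (g : G) : derived G g <-> exists w, g = cprod w.
Proof.
split.
- induction 1 as [|x y g _ [w ->]]; [now exists [] | now exists ((x, y) :: w)].
- intros [w ->]. induction w as [|p w IH]; [apply derived1 | now apply derivedM].
Qed.

Definition Rpair {A B : Type} (R : A -> B -> Prop) (p : A * A) (q : B * B) : Prop :=
  R (fst p) (fst q) /\ R (snd p) (snd q).

Lemma Forall2_Rpair_rev {A B : Type} (R : A -> B -> Prop) w w' :
  Forall2 (Rpair R) w w' -> Forall2 (Rpair R) (map swap (rev w)) (map swap (rev w')).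
Proof.
induction 1 as [|p q w w' [H1 H2] _ IH]; simpl; [constructor |].
rewrite !map_app. apply Forall2_app; trivial. repeat constructor; assumption.
Qed.

(** * Isoclinism from a correspondence *)

(** Only one direction is stated, so that it can be applied to [R] and to its converse. *)
Lemma correspondence_coset (G H : grp) (R : G -> H -> Prop) :
  (forall h, exists g, R g h) ->
  (forall w w', Forall2 (Rpair R) w w' -> cprod w = 1 -> cprod w' = 1) ->
  forall x y h k, R x h -> R y k -> cosetZ_eq G x y -> cosetZ_eq H h k.
Proof.
intros Hr Hw x y h k Hx Hy E. apply coset_of_comm. intros l.
destruct (Hr l) as [g Hg].
assert (Hp : cprod [(h, l); (l, k)] = 1).
{ apply (Hw [(x, g); (g, y)]).
  - repeat constructor; assumption.
  - simpl. rewrite gmul1r, (comm_coset_l _ _ g E), <- ginv_comm. apply gmulVl. }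
simpl in Hp. rewrite gmul1r, <- (ginv_comm k l) in Hp. now apply gmul_eq1.
Qed.

(* The last hypothesis alone makes the induced maps on G' and on G/Z(G) well defined and
   injective: x and y lie in the same coset of the center iff each product
   [x, g][g, y] of two commutators is trivial. *)
Lemma isoclinic_correspondence (G H : grp) (R : G -> H -> Prop) :
  (forall g, exists h, R g h) ->
  (forall h, exists g, R g h) ->
  (forall g g' h h', R g h -> R g' h' -> R (g * g') (h * h')) ->
  (forall w w', Forall2 (Rpair R) w w' -> (cprod w = 1 <-> cprod w' = 1)) ->
  isoclinic G H.
Proof.
intros Rl Rr Rm Rw.
assert (Hcos : forall x y h k, R x h -> R y k -> (cosetZ_eq G x y <-> cosetZ_eq H h k)).
{ intros x y h k Hx Hy; split.
  - apply (correspondence_coset G H R); trivial. intros w w' Hww. now apply Rw.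
  - apply (correspondence_coset H G (fun b a => R a b)); trivial.
    intros w w' Hww. apply Rw. apply Forall2_flip in Hww. exact Hww. }
(* [D] is the graph of the isomorphism G' -> H'. It is single-valued and injective because two words
   agree exactly when one followed by the inverse of the other is trivial. *)
set (D := fun g h => exists w w', Forall2 (Rpair R) w w' /\ g = cprod w /\ h = cprod w').
assert (Dinj : forall g g' h h', D g h -> D g' h' -> (g = g' <-> h = h')).
{ intros ? ? ? ? (w & w' & Hw & -> & ->) (v & v' & Hv & -> & ->).
  rewrite <- gmul_eq1, <- (gmul_eq1 (cprod w')), <- !cprod_rev, <- !cprod_app.
  apply Rw, Forall2_app; trivial. now apply Forall2_Rpair_rev. }
assert (DM : forall g g' h h', D g h -> D g' h' -> D (g * g') (h * h')).
{ intros ? ? ? ? (w & w' & Hw & -> & ->) (v & v' & Hv & -> & ->).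
  exists (w ++ v), (w' ++ v'). rewrite !cprod_app. repeat split. now apply Forall2_app. }
assert (Dl : forall g, derived G g -> exists h, D g h).
{ induction 1 as [|x y g _ [h Hh]].
  - exists 1, [], []. repeat constructor.
  - destruct (Rl x) as [x' Hx]. destruct (Rl y) as [y' Hy].
    exists ([~ x', y'] * h). apply DM; trivial.
    exists [(x, y)], [(x', y')]. simpl. rewrite !gmul1r.
    repeat constructor; assumption. }
assert (Dr : forall h, derived H h -> exists g, D g h).
{ induction 1 as [|x y g _ [h Hh]].
  - exists 1, [], []. repeat constructor.
  - destruct (Rr x) as [x' Hx]. destruct (Rr y) as [y' Hy].
    exists ([~ x', y'] * h). apply DM; trivial.
    exists [(x', y')], [(x, y)]. simpl. rewrite !gmul1r.
    repeat constructor; assumption. }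
assert (Dd : forall g h, D g h -> derived G g /\ derived H h).
{ intros g h (w & w' & _ & -> & ->). split; apply derivedP; eauto. }
set (f := fun g => epsilon (inhabits 1) (R g)).
assert (Hf : forall g, R g (f g)) by (intros g; apply epsilon_spec, Rl).
(* Outside G' the value of [psi] is arbitrary. *)
set (psi := fun g => epsilon (inhabits 1) (D g)).
assert (Hpsi : forall g, derived G g -> D g (psi g)).
{ intros g Hg. now apply epsilon_spec, Dl. }
assert (psiE : forall g h, D g h -> psi g = h).
{ intros g h Hgh. apply (Dinj g g); trivial. apply Hpsi. now apply (Dd g h). }
exists f, psi. repeat split.
- intros x y. now apply Hcos.
- intros x y. apply (Hcos (x * y) (x * y)); auto using coset_refl.
- intros x y. now apply Hcos.
- intros h. destruct (Rr h) as [x Hx]. exists x.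
  apply (Hcos x x); auto using coset_refl.
- intros g Hg. now apply (Dd g), Hpsi.
- intros g g' Hg Hg'. apply psiE. now apply DM; apply Hpsi.
- intros g g' Hg Hg'. now apply Dinj; apply Hpsi.
- intros h Hh. destruct (Dr h Hh) as [g Hg]. exists g. split; [now apply (Dd g h) |].
  now apply psiE.
- intros g1 g2 h1 h2 H1 H2. rewrite <- (comm_coset _ _ _ _ H1 H2). apply psiE.
  exists [(g1, g2)], [(f g1, f g2)]. simpl. rewrite !gmul1r. repeat constructor; apply Hf.
Qed.

(** Elements commute iff their commutator is 1, and [psi] is injective on G' with [psi 1 = 1]; so
    the map of cosets matches centralizers, and representatives in G lift through its
    surjectivity. *)
Lemma isoclinic_num_centralizers (K G : grp) (n : nat) :
  isoclinic K G -> num_centralizers G n -> num_centralizers K n.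
Proof.
intros (f & psi & _ & _ & _ & fsurj & _ & psiM & psiI & _ & Hc) (c & cinj & csurj).
assert (psi1 : psi 1 = 1).
{ apply (gmulI (psi 1)).
  rewrite <- psiM by apply derived1. now rewrite gmul1l, gmul1r. }
assert (Hcen : forall x y h k, cosetZ_eq G (f x) h -> cosetZ_eq G (f y) k ->
  (centralizer K x y <-> centralizer G h k)).
{ intros x y h k Hx Hy. unfold centralizer.
  rewrite <- !comm_eq1, <- (Hc _ _ _ _ Hx Hy). split; [intros ->; exact psi1 |].
  intros E. apply psiI; [| apply derived1 | now rewrite psi1].
  apply derivedP. exists [(x, y)]. simpl. now rewrite gmul1r. }
assert (Hsame : forall x y h k, cosetZ_eq G (f x) h -> cosetZ_eq G (f y) k ->
  (same_centralizer K x y <-> same_centralizer G h k)).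
{ intros x y h k Hx Hy. split; intros E z.
  - destruct (fsurj z) as [z' Hz].
    now rewrite <- (Hcen x z'), <- (Hcen y z') by assumption.
  - rewrite (Hcen x z h (f z)), (Hcen y z k (f z)); auto using coset_refl. }
set (d := fun i => epsilon (inhabits 1) (fun x => cosetZ_eq G (f x) (c i))).
assert (Hd : forall i, cosetZ_eq G (f (d i)) (c i)).
{ intros i. apply (epsilon_spec (inhabits 1) (fun x => cosetZ_eq G (f x) (c i))), fsurj. }
exists d. split.
- intros i j Hi Hj E. apply cinj; trivial. now apply (Hsame (d i) (d j)).
- intros x. destruct (csurj (f x)) as (i & Hi & E). exists i. split; trivial.
  now apply (Hsame x (d i) (f x) (c i) (coset_refl _)).
Qed.

(** * Bounding the index of the center *)

(** This says |G : Z(G)| <= M. The [t i] may repeat a coset, so that one [M] can serve many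
    groups. *)
Definition covers (G : grp) (t : nat -> G) (M : nat) : Prop :=
  forall x, exists i, i < M /\ cosetZ_eq G x (t i).

Lemma Forall2_classes {G : grp} (f : nat -> G) (n : nat) (xs : list G) :
  (forall x, exists i, i < n /\ same_centralizer G x (f i)) ->
  exists w, incl w (seq 0 n) /\ length w = length xs /\
    Forall2 (fun x i => same_centralizer G x (f i)) xs w.
Proof.
intros Hf. induction xs as [|x xs (w & Hi & Hl & Hw)].
- exists []. repeat constructor. intros a [].
- destruct (Hf x) as (i & Hin & Hx). exists (i :: w).
  split; [| split; [simpl; congruence | now constructor]].
  intros j [<- | Hj]; [apply in_seq; lia | auto].
Qed.

(* [y'] commutes with [y] and [x * y'] with [x * y]; cancelling, [y^-1 * y'] commutes
   with [x]. *)
Lemma same_centralizer_translate {G : grp} (x y y' : G) :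
  same_centralizer G y y' -> same_centralizer G (x * y) (x * y') ->
  x * (y^-1 * y') = y^-1 * y' * x.
Proof.
intros H1 H2.
assert (E1 : y * y' = y' * y) by (apply H1; reflexivity).
assert (E2 : x * y * (x * y') = x * y' * (x * y)) by (apply H2; reflexivity).
assert (E3 : y * (x * y') = y' * (x * y)).
{ apply (gmulI x). revert E2. now gsimpl. }
assert (E4 : y^-1 * y' = y' * y^-1).
{ apply (gmulI y), (gmulIr y). gsimpl. now rewrite E1. }
transitivity (x * (y' * y^-1)); [now rewrite E4 |].
apply (gmulI y), (gmulIr y). now gsimpl.
Qed.

Lemma center_index_bound (n : nat) :
  exists M, forall G : grp, num_centralizers G n ->
    exists t : nat -> G, t 0 = 1 /\ covers G t M.
Proof.
(* A word of length n + 1 records the centralizer classes of y and of all [f i * y]. *)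
destruct (finite_words (seq 0 n) (S n)) as [L HL].
exists (S (length L)). intros G (f & _ & Hf).
set (xs := 1 :: map f (seq 0 n)).
set (R := fun w y => Forall2 (fun x i => same_centralizer G (x * y) (f i)) xs w).
destruct (finite_image R L) as (ys & Hlen & Hys).
(* The identity is put in front to get [t 0 = 1], which accounts for the successor in the bound. *)
exists (fun i => nth i (1 :: ys) 1). split; trivial. intros y.
destruct (Forall2_classes f n (map (fun x => x * y) xs) Hf) as (w & Hi & Hl & Hw).
assert (HR : R w y).
{ unfold R. clear -Hw. clearbody xs. revert w Hw.
  induction xs as [|x l IH]; intros w Hw; inversion Hw; subst; constructor; auto. }
assert (HwL : In w L).
{ apply HL; trivial. rewrite Hl. unfold xs. simpl. rewrite !length_map, length_seq. lia. }
destruct (Hys w y HwL HR) as (y' & Hin & HR').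
assert (Hsame : forall x, In x xs -> same_centralizer G (x * y) (x * y')).
{ unfold R in HR, HR'. clear -HR HR'. clearbody xs. revert w HR HR'.
  induction xs as [|x l IH]; intros w H H'; [intros _ [] |].
  inversion H; subst. inversion H'; subst.
  intros x' [<- | Hx']; [| eapply IH; eauto].
  intros z. etransitivity; [| symmetry]; eauto. }
destruct (In_nth ys y' 1 Hin) as (i & Hilt & Ei).
exists (S i). split; [lia |]. simpl. rewrite Ei. intros x.
(* Some [f j] has the same centralizer as [x], so it is enough that [y^-1 * y'] commutes with
   [f j]. *)
destruct (Hf x) as (j & Hj & Hx). symmetry. apply Hx.
apply same_centralizer_translate.
- generalize (Hsame 1 (or_introl eq_refl)). now rewrite !gmul1l.
- apply Hsame. right. apply in_map, in_seq. lia.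
Qed.

(** * Schur's theorem: short products of commutators, and torsion of G' *)

Lemma comm_pow_shorten {G : grp} (x y : G) k :
  center G ([~ x, y] ^ (S k)) ->
  exists w : list (G * G), length w = S k /\ [~ x, y] ^ (S (S k)) = cprod w.
Proof.
intros Hz. set (c := [~ x, y]) in *.
assert (Hw : forall a b : G, forall j,
  exists w : list (G * G), length w = j /\ [~ a, b] ^ j = cprod w).
{ intros a b. induction j as [|j (w & Hl & Hw)]; [now exists [] |].
  exists ((a, b) :: w). simpl. now rewrite Hl, Hw. }
(* Since c^(k+1) commutes with y, c^(k+2) = c y^-1 c^(k+1) y = [x, y^2] (y^-1 c y)^k, where y^-1 c y
   = [y^-1 x y, y]. This has one factor fewer. *)
destruct (Hw (y^-1 * (x * y)) y k) as (w & Hl & Hp).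
exists ((x, y * y) :: w). split; [simpl; congruence |]. simpl cprod.
rewrite <- Hp.
replace [~ y^-1 * (x * y), y] with (y^-1 * (c * y)) by (unfold c; group).
rewrite gpow_conj.
replace ([~ x, y * y] * (y^-1 * (c ^ k * y))) with (x^-1 * (y^-1 * (x * (c ^ (S k) * y))))
  by (simpl; unfold c; group).
rewrite (Hz y). change (c ^ S (S k)) with (c * c ^ S k). unfold c at 1. group.
Qed.

Lemma center_pow {G : grp} (t : nat -> G) M (g : G) :
  covers G t M -> exists k, S k <= M /\ center G (g ^ (S k)).
Proof.
intros Ht.
destruct (pigeonhole (seq 0 M) (fun i j => cosetZ_eq G (g ^ i) (t j))) as (i & j & a & Hij & Hj & Hi & Hja).
- intros i. destruct (Ht (g ^ i)) as (j & Hj & E). exists j. split; trivial.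
  apply in_seq; lia.
- rewrite length_seq in Hj. exists (pred (j - i)). split; [lia |].
  replace (S (pred (j - i))) with (j - i) by lia.
  rewrite <- gpow_eq_diff by lia. exact (coset_trans _ _ _ Hi (coset_sym _ _ Hja)).
Qed.

Definition index_pairs (M : nat) : list (nat * nat) := list_prod (seq 0 M) (seq 0 M).

(** An index word can be evaluated in any group with chosen representatives, which makes word
    identities comparable across groups. *)
Definition ev {G : grp} (t : nat -> G) (w : list (nat * nat)) : G :=
  cprod (map (fun p => (t (fst p), t (snd p))) w).

Lemma ev_of_cprod {G : grp} (t : nat -> G) M (w : list (G * G)) : covers G t M ->
  exists v, incl v (index_pairs M) /\ length v = length w /\ ev t v = cprod w.
Proof.
intros Ht. induction w as [|[x y] w (v & Hi & Hl & E)].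
- exists []. repeat split. intros a [].
- destruct (Ht x) as (i & Him & Hx). destruct (Ht y) as (j & Hjm & Hy).
  exists ((i, j) :: v). repeat split.
  + intros a [<- | Ha]; auto. apply in_prod; apply in_seq; lia.
  + simpl; congruence.
  + unfold ev in *. simpl. now rewrite E, (comm_coset _ _ _ _ Hx Hy).
Qed.

Definition pair_dec (a b : nat * nat) : {a = b} + {a <> b}.
Proof. decide equality; apply Nat.eq_dec. Defined.

Lemma ev_extract {G : grp} (t : nat -> G) c w k : k <= count_occ pair_dec w c ->
  exists v : list (G * G), length w = k + length v /\
    ev t w = [~ t (fst c), t (snd c)] ^ k * cprod v.
Proof.
set (z := [~ t (fst c), t (snd c)]).
assert (E0 : forall w, exists v : list (G * G), length w = length v /\ ev t w = cprod v).
{ intros u. eexists. split; [| reflexivity]. now rewrite length_map. }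
revert k; induction w as [|a w IH]; intros k Hk.
- simpl in Hk. replace k with 0 by lia. exists []. split; trivial. simpl. group.
- simpl in Hk. destruct (pair_dec a c) as [-> | Hne].
  + destruct k as [|k].
    * destruct (E0 (c :: w)) as (v & Hl & E). exists v. split; trivial.
      rewrite E. simpl. group.
    * destruct (IH k) as (v & Hl & E); [lia |]. exists v. split; [simpl; lia |].
      change (ev t (c :: w)) with (z * ev t w). rewrite E. simpl. group.
  + destruct (IH k Hk) as (v & Hl & E).
    (* Moving [z ^ k] to the left past a commutator conjugates it, and a conjugate of a commutator
       is a commutator, so the length is preserved. *)
    exists (((z ^ k)^-1 * (t (fst a) * z ^ k), (z ^ k)^-1 * (t (snd a) * z ^ k)) :: v).
    split; [simpl; lia |].
    change (ev t (a :: w)) with ([~ t (fst a), t (snd a)] * ev t w).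
    rewrite E. simpl. group.
Qed.

(* A commutator occurring more than |G : Z(G)| times can be collected to the front,
   where [comm_pow_shorten] removes one factor. *)
Lemma ev_shorten {G : grp} (t : nat -> G) M w : covers G t M ->
  incl w (index_pairs M) -> M * M * M < length w ->
  exists v : list (G * G), S (length v) = length w /\ ev t w = cprod v.
Proof.
intros Ht Hi Hlen.
destruct (classic (exists c, M < count_occ pair_dec w c)) as [[c Hc] | Hno].
- destruct (center_pow t M [~ t (fst c), t (snd c)] Ht) as (k & Hk & Hz).
  destruct (comm_pow_shorten _ _ _ Hz) as (u & Hu & Eu).
  destruct (ev_extract t c w (S (S k))) as (v & Hv & Ev); [lia |].
  exists (u ++ v). rewrite length_app, cprod_app, <- Eu. split; [lia | trivial].
- exfalso. apply (Nat.lt_irrefl (length w)).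
  eapply Nat.le_lt_trans; [apply (length_le_occ _ _ pair_dec M Hi) |].
  + intros c. apply Nat.nlt_ge. intros H. apply Hno. now exists c.
  + unfold index_pairs. now rewrite length_prod, length_seq.
Qed.

(** Shortening produces commutators of arbitrary elements; [ev_of_cprod] turns them back into
    commutators of representatives, and the process repeats. *)
Lemma schur {G : grp} (t : nat -> G) M (w : list (G * G)) : covers G t M ->
  exists v, incl v (index_pairs M) /\ length v <= M * M * M /\ cprod w = ev t v.
Proof.
intros Ht. remember (length w) as l eqn:Hl. revert w Hl.
induction l as [|l IH]; intros w Hl; destruct (ev_of_cprod t M w Ht) as (v & Hi & Hv & E).
- exists v. rewrite E. repeat split; trivial; lia.
- destruct (le_lt_dec (length v) (M * M * M)) as [Hle | Hgt].
  + exists v. rewrite E. repeat split; trivial; lia.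
  + destruct (ev_shorten t M v Ht Hi Hgt) as (u & Hu & Eu).
    rewrite <- E, Eu. apply IH. lia.
Qed.

(** All powers of [g] are values of finitely many bounded words, so two of them coincide. *)
Lemma derived_torsion {G : grp} (t : nat -> G) M (g : G) : covers G t M ->
  derived G g -> exists r, 0 < r /\ g ^ r = 1.
Proof.
intros Ht Hg. apply derivedP in Hg. destruct Hg as [w Hw].
destruct (finite_words (index_pairs M) (M * M * M)) as [L HL].
destruct (pigeonhole L (fun i v => g ^ i = ev t v)) as (i & j & v & Hij & _ & Hi & Hj).
- intros i.
  assert (Hp : exists u, g ^ i = cprod u).
  { induction i as [|i [u Hu]]; [now exists [] |]. exists (w ++ u).
    simpl. now rewrite cprod_app, Hu, Hw. }
  destruct Hp as [u ->]. destruct (schur t M u Ht) as (v & Hv & Hl & E).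
  exists v. split; auto.
- exists (j - i). split; [lia |].
  rewrite <- gpow_eq_diff by lia. rewrite Hi, Hj. apply gmulVl.
Qed.

(** * Isoclinism from finitely many word identities *)

Lemma isoclinic_of_tables (G H : grp) (t : nat -> G) (s : nat -> H) (M : nat) :
  covers G t M -> covers H s M ->
  (forall i j k, i < M -> j < M -> k < M ->
     (cosetZ_eq G (t i * t j) (t k) <-> cosetZ_eq H (s i * s j) (s k))) ->
  (forall v w, incl v (index_pairs M) -> incl w (index_pairs M) ->
     length v <= S (M * M * M) -> length w <= S (M * M * M) ->
     (ev t v = ev t w <-> ev s v = ev s w)) ->
  isoclinic G H.
Proof.
intros Ht Hs Hmul Hev.
apply (isoclinic_correspondence G H
  (fun x y => exists i, i < M /\ cosetZ_eq G x (t i) /\ cosetZ_eq H y (s i))).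
- intros x. destruct (Ht x) as (i & Hi & Hx). exists (s i), i. auto using coset_refl.
- intros y. destruct (Hs y) as (i & Hi & Hy). exists (t i), i. auto using coset_refl.
- intros x x' y y' (i & Hi & Hx & Hy) (j & Hj & Hx' & Hy').
  destruct (Ht (t i * t j)) as (k & Hk & E). exists k. repeat split; trivial.
  + exact (coset_trans _ _ _ (coset_mul _ _ _ _ Hx Hx') E).
  + apply (coset_trans _ _ _ (coset_mul _ _ _ _ Hy Hy')). now apply Hmul.
- intros w w' Hw.
  (* One index word [u] evaluates to both products. Prepending a commutator gives length at most M^3
     + 1; it is shortened in G, and [Hev] transfers that equality to H. Triviality is then
     comparison with the empty word. *)
  assert (Hcommon : exists u, incl u (index_pairs M) /\ length u <= M * M * M /\
    cprod w = ev t u /\ cprod w' = ev s u).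
  { induction Hw as [|[x y] [x' y'] w w' [Hx Hy] _ (u & Hi & Hl & E & E')].
    - exists []. repeat split; simpl; auto using incl_nil_l, Nat.le_0_l.
    - destruct Hx as (i & Him & Hx & Hx'). destruct Hy as (j & Hjm & Hy & Hy').
      simpl in Hx, Hx', Hy, Hy'.
      assert (Hi1 : incl ((i, j) :: u) (index_pairs M)).
      { intros a [<- | Ha]; auto. apply in_prod; apply in_seq; lia. }
      destruct (schur t M (map (fun p => (t (fst p), t (snd p))) ((i, j) :: u)) Ht)
        as (v & Hv & Hvl & Ev).
      exists v. repeat split; trivial.
      + rewrite <- Ev. simpl. rewrite E. f_equal. now apply comm_coset.
      + transitivity (ev s ((i, j) :: u)).
        * simpl. rewrite E'. unfold ev. simpl. f_equal. now apply comm_coset.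
        * apply Hev; trivial; simpl; lia. }
  destruct Hcommon as (u & Hi & Hl & -> & ->).
  apply (Hev u []); trivial; simpl; auto using incl_nil_l, Nat.le_0_l; lia.
Qed.

Lemma finite_isoclinism_classes (M : nat) :
  exists Hs : list grp, forall (G : grp) (t : nat -> G), covers G t M ->
    exists H, In H Hs /\ isoclinic G H.
Proof.
destruct (finite_words (index_pairs M) (S (M * M * M))) as [L HL].
(* Pairs of a group and its representatives are sorted by the truth values of finitely many
   statements: coset products and equalities of short words. *)
destruct (finite_types (X := {G : grp & nat -> G})
  (A := nat * nat * nat + list (nat * nat) * list (nat * nat))
  (fun X a => let t := projT2 X in
     match a with
     | inl (i, j, k) => cosetZ_eq _ (t i * t j) (t k)
     | inr (v, w) => ev t v = ev t w
     end)
  (map inl (list_prod (index_pairs M) (seq 0 M)) ++ map inr (list_prod L L))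
  (fun X => covers _ (projT2 X) M)) as [Xs HXs].
exists (map (@projT1 _ _) Xs). intros G t Ht.
destruct (HXs (existT _ G t) Ht) as ([H s] & Hin & Hs & HT). simpl in *.
exists H. split; [exact (in_map (@projT1 _ _) _ _ Hin) |].
apply (isoclinic_of_tables G H t s M); trivial.
- intros i j k Hi Hj Hk. apply (HT (inl (i, j, k))), in_or_app. left.
  apply in_map. repeat apply in_prod; apply in_seq; lia.
- intros v w Hv Hw Hlv Hlw. apply (HT (inr (v, w))), in_or_app. right.
  apply in_map. apply in_prod; auto.
Qed.

(** * Finitely generated central subgroups *)

(** For central [l] this is the subgroup generated by [l]; an integer exponent is written as the
    difference of the natural numbers [p] and [q]. *)
Fixpoint span {G : grp} (l : list G) : G -> Prop :=
  match l with
  | [] => fun z => z = 1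
  | s :: l => fun z => exists p q h, span l h /\ z = s ^ p * (s ^ q)^-1 * h
  end.

Lemma centralACA {G : grp} (a h a' h' : G) : center G a' ->
  a * h * (a' * h') = a * a' * (h * h').
Proof. intros Ha. now rewrite <- !gmulA, (gmulA _ h a'), <- (Ha h), !gmulA. Qed.

Lemma span_center {G : grp} (l : list G) z :
  Forall (center G) l -> span l z -> center G z.
Proof.
intros Hl. revert z. induction Hl as [|s l Hs _ IH]; simpl.
- intros z ->. apply center1.
- intros z (p & q & h & Hh & ->). auto using centerM, centerV, centerX.
Qed.

Lemma span1 {G : grp} (l : list G) : span l 1.
Proof.
induction l as [|s l IH]; simpl; trivial. exists 0, 0, 1. split; trivial. simpl. group.
Qed.

Lemma span_in {G : grp} (l : list G) s : In s l -> span l s.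
Proof.
induction l as [|s' l IH]; [intros [] |]. intros [-> | Hs].
- exists 1%nat, 0, 1. split; [apply span1 |]. simpl. group.
- exists 0, 0, s. split; auto. simpl. group.
Qed.

Lemma spanM {G : grp} (l : list G) z w : Forall (center G) l ->
  span l z -> span l w -> span l (z * w).
Proof.
intros Hl. revert z w. induction Hl as [|s l Hs Hl IH]; simpl.
- intros z w -> ->. group.
- intros z w (p & q & h & Hh & ->) (p' & q' & h' & Hh' & ->).
  exists (p + p')%nat, (q' + q)%nat, (h * h'). split; auto.
  rewrite !gpow_add, ginvM, (centralACA _ h) by auto using centerM, centerX, centerV.
  f_equal. apply centralACA. now apply centerX.
Qed.

Lemma spanV {G : grp} (l : list G) z : Forall (center G) l -> span l z -> span l (z^-1).
Proof.
intros Hl. revert z. induction Hl as [|s l Hs Hl IH]; simpl.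
- intros z ->. group.
- intros z (p & q & h & Hh & ->). exists q, p, (h^-1). split; auto.
  rewrite !ginvM, ginvK. symmetry. apply centerM; auto using centerX, centerV.
Qed.

Lemma spanX {G : grp} (l : list G) z k : Forall (center G) l -> span l z -> span l (z ^ k).
Proof. intros Hl Hz. induction k; simpl; [apply span1 | now apply spanM]. Qed.

(* If no positive power of [s] lies in the span of [l], a torsion element
   [s^p s^-q h] has [p = q]; otherwise multiply the exponents. *)
Lemma span_torsion_exponent {G : grp} (l : list G) : Forall (center G) l ->
  exists e, 0 < e /\ forall z r, span l z -> 0 < r -> z ^ r = 1 -> z ^ e = 1.
Proof.
induction 1 as [|s l Hs Hl (e & He & IH)].
- exists 1%nat. split; auto. intros z r -> _ _. apply gpow1.
- assert (HX : forall p q h k, span l h ->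
    (s ^ p * (s ^ q)^-1 * h) ^ k = s ^ (k * p) * (s ^ (k * q))^-1 * h ^ k).
  { intros p q h k Hh.
    assert (Hp := centerX s p Hs). assert (Hq := centerV _ (centerX s q Hs)).
    rewrite !gpowM, gpowV, <- !gpow_mul; auto. apply centerM; trivial. }
  destruct (classic (exists d, 0 < d /\ span l (s ^ d))) as [(d & Hd & Hsd) | Hno].
  + exists (e * d)%nat. split; [lia |].
    intros z r (p & q & h & Hh & ->) Hr E. rewrite gpow_mul.
    apply (IH _ r); trivial.
    * rewrite HX, (Nat.mul_comm d p), (Nat.mul_comm d q), !gpow_mul by trivial.
      auto using spanM, spanV, spanX.
    * rewrite <- gpow_mul, Nat.mul_comm, gpow_mul, E. apply gpow1.
  + exists e. split; trivial. intros z r (p & q & h & Hh & ->) Hr E.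
    (* So s^(r(p - q)) lies in the span of [l], and p <> q would put a positive power of [s]
       there. *)
    assert (E' : (s ^ (r * q))^-1 * s ^ (r * p) = (h ^ r)^-1).
    { rewrite HX in E by trivial. apply (gmulIr (h ^ r)).
      rewrite gmulVl, <- E. f_equal. symmetry. apply centerX; trivial. }
    assert (Hh' : span l ((h ^ r)^-1)) by auto using spanV, spanX.
    destruct (lt_eq_lt_dec p q) as [[H | ->] | H].
    * exfalso. apply Hno. exists (r * q - r * p)%nat. split; [nia |].
      rewrite <- gpow_eq_diff by nia.
      replace ((s ^ (r * p))^-1 * s ^ (r * q)) with ((s ^ (r * q))^-1 * s ^ (r * p))^-1
        by group.
      rewrite E'. now apply spanV.
    * rewrite gmulVr, gmul1l in E |- *. now apply (IH h r).
    * exfalso. apply Hno. exists (r * p - r * q)%nat. split; [nia |].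
      rewrite <- gpow_eq_diff by nia. now rewrite E'.
Qed.

(** The e-th powers have finite index: the exponent of each generator is reduced modulo e. *)
Lemma span_mod_powers {G : grp} (l : list G) e : Forall (center G) l -> 0 < e ->
  exists L, forall z, span l z -> exists v w, In v L /\ span l w /\ z = v * w ^ e.
Proof.
intros Hl He. induction Hl as [|s l Hs Hl [L IH]].
- exists [1]. intros z ->. exists 1, 1. rewrite gpow1. repeat split; [now left | group].
- exists (flat_map (fun r => map (fun v => s ^ r * v) L) (seq 0 e)).
  intros z (p & q & h & Hh & ->). destruct (IH h Hh) as (v & w & Hv & Hw & ->).
  (* [m] is a natural number congruent to p - q modulo e, and p - q = m mod e + e (m / e - q). *)
  set (m := (p + q * (e - 1))%nat).
  exists (s ^ (m mod e) * v), (s ^ (m / e) * (s ^ q)^-1 * w). split; [| split].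
  + apply in_flat_map. exists (m mod e). split.
    * apply in_seq. generalize (Nat.mod_upper_bound m e). lia.
    * now apply in_map with (f := fun v => s ^ (m mod e) * v).
  + now exists (m / e)%nat, q, w.
  + assert (Hm : e * (m / e) + m mod e = p + q * (e - 1)).
    { symmetry. apply Nat.div_mod. lia. }
    assert (Hm1 := centerX s (m / e) Hs). assert (Hm2 := centerV _ (centerX s q Hs)).
    rewrite !gpowM by first [apply Hm1 | now apply centerM].
    rewrite gpowV, <- !gpow_mul, (centralACA (s ^ (m mod e))) by auto using centerM, centerX, centerV.
    f_equal. apply (gmulIr (s ^ (e * q))). gsimpl.
    rewrite <- gpow_add, Nat.add_comm, Hm.
    replace (e * q)%nat with (q * (e - 1) + q)%nat by nia.
    rewrite !gpow_add.
    rewrite <- (centerX s q Hs (s ^ (q * (e - 1)))). gsimpl. reflexivity.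
Qed.

(** * Central quotients of subgroups *)

(* [K] is P/N, each element being sent by [iota] to a representative of its coset. *)
Lemma section_group (G : grp) (P N : G -> Prop) :
  subgroup P -> subgroup N -> (forall x, N x -> P x) -> (forall x, N x -> center G x) ->
  exists (K : grp) (iota : K -> G),
    (forall k, P (iota k)) /\
    (forall x, P x -> exists k, N (x^-1 * iota k)) /\
    (forall k k', N ((iota k)^-1 * iota k') -> k = k') /\
    (forall k k', N ((iota (gmul k k'))^-1 * (iota k * iota k'))).
Proof.
intros [P1 PM PV] HN NP NZ.
set (rep := fun x => epsilon (inhabits 1) (fun y => N (x^-1 * y))).
assert (Hrep : forall x, N (x^-1 * rep x)).
{ intros x. apply (epsilon_spec (inhabits 1) (fun y => N (x^-1 * y))).
  exists x. rewrite gmulVl. apply HN. }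
assert (Nsym := fun x y => congr_sym N x y HN).
assert (Ntrans := fun x y z => congr_trans N x y z HN).
assert (NMM := fun x x' y y' => congr_mul N x x' y y' HN NZ).
(* Congruent elements define extensionally equal coset predicates, so [epsilon] picks the same
   representative for both. The carrier can then consist of the fixed points of [rep] in [P]. *)
assert (repE : forall x y, N (x^-1 * y) -> rep x = rep y).
{ intros x y H. unfold rep. f_equal. apply functional_extensionality. intros z.
  apply propositional_extensionality. split; apply Ntrans; auto. }
assert (Prep : forall x, P x -> P (rep x)).
{ intros x Hx. rewrite <- (gmulKr x (rep x)). auto. }
set (T := {x : G | P x /\ rep x = x}).
assert (Hmk : forall x, P x -> P (rep x) /\ rep (rep x) = rep x).
{ intros x Hx. split; auto. }
set (mk := fun x (Hx : P x) => exist _ (rep x) (Hmk x Hx) : T).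
assert (Tinj : forall a b : T, N ((proj1_sig a)^-1 * proj1_sig b) -> a = b).
{ intros [a Ha] [b Hb] H. apply subset_eq_compat. simpl in H. apply repE in H.
  destruct Ha, Hb. congruence. }
assert (PT : forall a : T, P (proj1_sig a)) by (intros a; exact (proj1 (proj2_sig a))).
set (mul := fun a b : T => mk _ (PM _ _ (PT a) (PT b))).
set (inv := fun a : T => mk _ (PV _ (PT a))).
assert (Nrefl : forall x, N (x^-1 * x)) by (intros x; rewrite gmulVl; apply HN).
assert (Hmul : forall a b, N ((proj1_sig (mul a b))^-1 * (proj1_sig a * proj1_sig b))).
{ intros a b. apply Nsym, Hrep. }
assert (Hinv : forall a, N ((proj1_sig (inv a))^-1 * (proj1_sig a)^-1)).
{ intros a. apply Nsym, Hrep. }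
assert (Hone : N ((proj1_sig (mk 1 P1))^-1 * 1)) by apply Nsym, Hrep.
assert (mulA : forall a b c, mul a (mul b c) = mul (mul a b) c).
{ intros a b c. apply Tinj.
  apply (Ntrans _ (proj1_sig a * (proj1_sig b * proj1_sig c))).
  - apply (Ntrans _ _ _ (Hmul _ _)). now apply NMM.
  - rewrite gmulA. apply Nsym, (Ntrans _ _ _ (Hmul _ _)). now apply NMM. }
assert (mul1l : forall a, mul (mk 1 P1) a = a).
{ intros a. apply Tinj. apply (Ntrans _ _ _ (Hmul _ _)).
  apply (Ntrans _ (1 * proj1_sig a)); [now apply NMM | now rewrite gmul1l]. }
assert (mul1r : forall a, mul a (mk 1 P1) = a).
{ intros a. apply Tinj. apply (Ntrans _ _ _ (Hmul _ _)).
  apply (Ntrans _ (proj1_sig a * 1)); [now apply NMM | now rewrite gmul1r]. }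
assert (mulVl : forall a, mul (inv a) a = mk 1 P1).
{ intros a. apply Tinj. apply (Ntrans _ _ _ (Hmul _ _)).
  apply (Ntrans _ ((proj1_sig a)^-1 * proj1_sig a)); [now apply NMM |].
  rewrite gmulVl. auto. }
assert (mulVr : forall a, mul a (inv a) = mk 1 P1).
{ intros a. apply Tinj. apply (Ntrans _ _ _ (Hmul _ _)).
  apply (Ntrans _ (proj1_sig a * (proj1_sig a)^-1)); [now apply NMM |].
  rewrite gmulVr. auto. }
exists (Grp T mul (mk 1 P1) inv mulA mul1l mul1r mulVl mulVr), (@proj1_sig _ _).
repeat split; trivial.
intros x Hx. exists (mk x Hx). apply Hrep.
Qed.

(** Matching k with the coset of [iota k] carries commutator words to each other up to N. A word is
    trivial in K iff its value in G lies in N, and N meets G' trivially. *)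
Lemma section_isoclinic (G K : grp) (P N : G -> Prop) (iota : K -> G) :
  subgroup N -> (forall x, N x -> center G x) ->
  (forall x, P x -> exists k, N (x^-1 * iota k)) ->
  (forall k k', N ((iota k)^-1 * iota k') -> k = k') ->
  (forall k k', N ((iota (gmul k k'))^-1 * (iota k * iota k'))) ->
  (forall x, exists y, P y /\ cosetZ_eq G x y) ->
  (forall x, N x -> derived G x -> x = 1) ->
  isoclinic K G.
Proof.
intros HN NZ Hsurj Hinj Hmul HP HNG.
assert (Nsym := fun x y => congr_sym N x y HN).
assert (Ntrans := fun x y z => congr_trans N x y z HN).
assert (NMM := fun x x' y y' => congr_mul N x x' y y' HN NZ).
assert (Nrefl : forall x, N (x^-1 * x)) by (intros x; rewrite gmulVl; apply HN).
assert (H1 : N (iota 1)).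
{ generalize (Hmul 1 1). rewrite gmul1l. now gsimpl. }
assert (HV : forall k, N ((iota (ginv k))^-1 * (iota k)^-1)).
{ intros k. generalize (Hmul k (ginv k)). rewrite gmulVr. intros H.
  assert (E : N (iota k * iota (ginv k))).
  { rewrite <- (gmulKr (iota 1) (iota k * _)). now apply (subgroupM N HN). }
  apply (subgroupV N HN) in E. now rewrite ginvM in E. }
assert (Hcomm : forall k k', N ((iota [~ k, k'])^-1 * [~ iota k, iota k'])).
{ intros k k'. unfold comm. apply (Ntrans _ _ _ (Hmul _ _)).
  apply NMM; apply (Ntrans _ _ _ (Hmul _ _)); auto. }
assert (Hprod : forall w, N ((iota (cprod w))^-1 *
   cprod (map (fun p => (iota (fst p), iota (snd p))) w))).
{ induction w as [|p w IH]; simpl.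
  - rewrite gmul1r. now apply (subgroupV N HN).
  - apply (Ntrans _ _ _ (Hmul _ _)). now apply NMM. }
assert (Hclose : forall x y, N (x^-1 * y) -> cosetZ_eq G x y) by (intros x y; apply NZ).
apply (isoclinic_correspondence K G (fun k g => cosetZ_eq G (iota k) g)).
- intros k. exists (iota k). apply coset_refl.
- intros g. destruct (HP g) as (x & Hx & E). destruct (Hsurj x Hx) as [k Hk].
  exists k. apply coset_sym. exact (coset_trans _ _ _ E (Hclose _ _ Hk)).
- intros k k' g g' Hg Hg'.
  apply (coset_trans _ _ _ (Hclose _ _ (Hmul _ _))). now apply coset_mul.
- intros w w' Hw.
  assert (E : cprod w' = cprod (map (fun p => (iota (fst p), iota (snd p))) w)).
  { induction Hw as [|p q w w' [Hp Hq] _ IH]; simpl; trivial.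
    rewrite IH. f_equal. symmetry. now apply comm_coset. }
  generalize (Hprod w). rewrite <- E. intros H. split.
  + intros E1. rewrite E1 in H. apply HNG; [| apply derivedP; eauto].
    rewrite <- (gmulKr (iota 1) (cprod w')). now apply (subgroupM N HN).
  + intros E1. rewrite E1, gmul1r in H. apply Hinj.
    now apply (subgroupM N HN).
Qed.

Lemma finite_isoclinic (G : grp) (t : nat -> G) (M : nat) :
  t 0 = 1 -> covers G t M -> exists K, finite_grp K /\ isoclinic K G.
Proof.
intros t0 Ht.
(* The generators of Z_1 are those candidates that are central, that is, those where [t k]
   represents the product. *)
set (cand := flat_map (fun k => map (fun p => (t k)^-1 * (t (fst p) * t (snd p)))
  (index_pairs M)) (seq 0 M)).
set (isZ := fun z => if excluded_middle_informative (center G z) then true else false).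
set (l := filter isZ cand).
assert (HisZ : forall z, isZ z = true <-> center G z).
{ intros z. unfold isZ. destruct (excluded_middle_informative (center G z)); split; easy. }
assert (Hl : Forall (center G) l).
{ apply Forall_forall. intros z Hz. apply HisZ. now apply filter_In in Hz. }
assert (Hspan : forall i j k, i < M -> j < M -> k < M ->
  cosetZ_eq G (t k) (t i * t j) -> span l ((t k)^-1 * (t i * t j))).
{ intros i j k Hi Hj Hk E. apply span_in, filter_In. split; [| now apply HisZ].
  apply in_flat_map. exists k. split; [apply in_seq; lia |].
  apply in_map_iff. exists (i, j). split; trivial. apply in_prod; apply in_seq; lia. }
assert (M0 : 0 < M) by (destruct (Ht 1) as (i & Hi & _); lia).
destruct (span_torsion_exponent l Hl) as (e & He & Htors).
destruct (span_mod_powers l e Hl He) as [L HL].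
set (P := fun x => exists i z, i < M /\ span l z /\ x = t i * z).
set (N := fun x => exists w, span l w /\ x = w ^ e).
assert (Hz : forall z, span l z -> center G z) by (intros z; now apply span_center).
assert (HP : subgroup P).
{ split.
  - exists 0, 1. rewrite t0, gmul1l. auto using span1.
  - intros x y (i & z & Hi & Hsz & ->) (j & w & Hj & Hw & ->).
    destruct (Ht (t i * t j)) as (k & Hk & E). apply coset_sym in E.
    exists k, ((t k)^-1 * (t i * t j) * (z * w)). repeat split; auto using spanM.
    rewrite <- (gmulA _ (t i)), (gmulA _ z (t j) w), (Hz z Hsz (t j)). group.
  - intros x (i & z & Hi & Hsz & ->).
    destruct (Ht (t i)^-1) as (j & Hj & E).
    (* Here t_i t_j is central and, as t_0 = 1, one of the generators; the inverse of t_i z is t_j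
       (t_i t_j)^-1 z^-1. *)
    exists j, (((t 0)^-1 * (t i * t j))^-1 * z^-1). repeat split; trivial.
    + apply spanM; trivial; apply spanV; trivial. apply Hspan; trivial.
      revert E. unfold cosetZ_eq. rewrite t0. now gsimpl.
    + rewrite t0, ginvM, (centerV _ (Hz z Hsz)). group. }
assert (HN : subgroup N).
{ split.
  - exists 1. rewrite gpow1. auto using span1.
  - intros x y (z & Hsz & ->) (w & Hw & ->). exists (z * w). split; [now apply spanM |].
    symmetry. now apply gpowM, Hz.
  - intros x (z & Hsz & ->). exists (z^-1). rewrite gpowV. auto using spanV. }
assert (HNspan : forall x, N x -> span l x) by (intros x (w & Hw & ->); now apply spanX).
destruct (section_group G P N) as (K & iota & HPK & Hsurj & Hinj & Hmul); trivial.
{ intros x Hx. exists 0, x. rewrite t0, gmul1l. auto. }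
{ auto. }
exists K. split.
(* Each element of K is represented modulo N by some t_i v with v in the finite list [L]. *)
- destruct (finite_image (fun x k => N (x^-1 * iota k))
    (flat_map (fun i => map (fun v => t i * v) L) (seq 0 M))) as (ks & _ & Hks).
  exists ks. intros k. destruct (HPK k) as (i & z & Hi & Hsz & Ek).
  destruct (HL z Hsz) as (v & w & Hv & Hw & ->).
  destruct (Hks (t i * v) k) as (k' & Hk' & Hkk').
  + apply in_flat_map. exists i. split; [apply in_seq; lia |].
    now apply in_map with (f := fun v => t i * v).
  + rewrite Ek. exists w. split; trivial. group.
  + replace k with k'; trivial. apply Hinj.
    apply (congr_trans N _ (t i * v)); trivial; [now apply congr_sym |].
    rewrite Ek. exists w. split; trivial. group.
- apply (section_isoclinic G K P N iota); auto.
  + intros x. destruct (Ht x) as (i & Hi & E). exists (t i). split; trivial.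
    exists i, 1. rewrite gmul1r. auto using span1.
  + intros x (w & Hw & ->) Hd.
    (* As [w ^ e] is torsion, so is [w], and [e] was chosen to kill the torsion of Z_1. *)
    destruct (derived_torsion t M _ Ht Hd) as (r & Hr & Er).
    apply (Htors w (r * e)%nat); trivial; [nia | now rewrite gpow_mul].
Qed.

Local Close Scope grp_scope.

Theorem theorem3p3 (n : nat) (hn : 0 < n) (G : grp) (hG : num_centralizers G n) :
  (exists Hs : list grp,
     forall H : grp, num_centralizers H n ->
       exists H', In H' Hs /\ isoclinic H H') /\
  (exists K : grp, finite_grp K /\ isoclinic K G /\
     num_centralizers K n).
Proof.
destruct (center_index_bound n) as [M HM]. split.
- destruct (finite_isoclinism_classes M) as [Hs HHs].
  exists Hs. intros H hH. destruct (HM H hH) as (t & _ & Ht). exact (HHs H t Ht).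
- destruct (HM G hG) as (t & t0 & Ht).
  destruct (finite_isoclinic G t M t0 Ht) as (K & HK & Hiso).
  exists K. repeat split; trivial. now apply (isoclinic_num_centralizers K G).
Qed.
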